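(* Let $\mathbb{U}$ be a universe set, let $\mathcal{F}$ and $\mathcal{G}$ be two SVN-filter bases on $\mathcal{SVN}(\mathbb{U})$, and let $$\mathcal{F} \wedge \mathcal{G} = \left\{ \widetilde{F} \sqcup \widetilde{G} : \ \widetilde{F} \in \mathcal{F},\ \widetilde{G} \in \mathcal{G} \right\}$$ be the set of all neutrosophic unions of the members of $\mathcal{F}$ and $\mathcal{G}$. Then $\mathcal{F} \wedge \mathcal{G}$ is an SVN-filter base on $\mathcal{SVN}(\mathbb{U})$. Additionally, if $\mathcal{F}$ and $\mathcal{G}$ are SVN-filters on $\mathcal{SVN}(\mathbb{U})$, then $\mathcal{F} \wedge \mathcal{G}$ is an SVN-filter on $\mathcal{SVN}(\mathbb{U})$ which is coarser than both $\mathcal{F}$ and $\mathcal{G}$, i.e. $\mathcal{F} \wedge \mathcal{G} \subseteq \mathcal{F}$ and $\mathcal{F} \wedge \mathcal{G} \subseteq \mathcal{G}$.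
   Context: A single valued neutrosophic set (SVN-set) over a set $\mathbb{U}$ is a triple $\widetilde{A} = \langle \mu_A, \sigma_A, \omega_A \rangle$ of arbitrary functions $\mathbb{U} \to [0,1]$ (membership, indeterminacy, nonmembership). $\mathcal{SVN}(\mathbb{U})$ is the set of all SVN-sets over $\mathbb{U}$. Inclusion: $\widetilde{A} \sqsubseteq \widetilde{B}$ means $\mu_A(u) \le \mu_B(u)$, $\sigma_A(u) \le \sigma_B(u)$ and $\omega_A(u) \ge \omega_B(u)$ for every $u \in \mathbb{U}$. Two SVN-sets are equal if each is included in the other. Intersection: $\widetilde{A} \sqcap \widetilde{B} = \langle \min(\mu_A,\mu_B), \min(\sigma_A,\sigma_B), \max(\omega_A,\omega_B)\rangle$ (pointwise). Union: $\widetilde{A} \sqcup \widetilde{B} = \langle \max(\mu_A,\mu_B), \max(\sigma_A,\sigma_B), \min(\omega_A,\omega_B)\rangle$ (pointwise). The neutrosophic empty set is $\widetilde{\emptyset} = \langle 0,0,1\rangle$ (constant functions). A nonempty family $\mathcal{F} \subseteq \mathcal{SVN}(\mathbb{U})$ is an SVN-filter base on $\mathcal{SVN}(\mathbb{U})$ if $\widetilde{\emptyset} \notin \mathcal{F}$ and for every $\widetilde{F}, \widetilde{G} \in \mathcal{F}$ there exists $\widetilde{H} \in \mathcal{F}$ with $\widetilde{H} \sqsubseteq \widetilde{F} \sqcap \widetilde{G}$. It is an SVN-filter if it is an SVN-filter base and for every $\widetilde{F} \in \mathcal{F}$ and every $\widetilde{A} \in \mathcal{SVN}(\mathbb{U})$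 with $\widetilde{F} \sqsubseteq \widetilde{A}$ one has $\widetilde{A} \in \mathcal{F}$. *)

(* Defs.v *)
From HB Require Import structures.
From mathcomp Require Import all_boot all_order all_algebra.
From mathcomp Require Import interval_inference.
From mathcomp Require Import boolp classical_sets reals.

Set Implicit Arguments.
Unset Strict Implicit.
Unset Printing Implicit Defensive.

Import Order.TTheory GRing.Theory Num.Theory.

Local Open Scope classical_set_scope.
Local Open Scope ring_scope.

Record svnset (R : realType) (U : Type) := SVNSet {
  membership : U -> {i01 R};
  indeterminacy : U -> {i01 R};
  nonmembership : U -> {i01 R} }.

Definition svn_sub (R : realType) (U : Type) (A B : svnset R U) : Prop :=
  forall u : U,
    [/\ membership A u <= membership B u,
        indeterminacy A u <= indeterminacy B u
      & nonmembership A u >= nonmembership B u].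

(* Inclusion in both directions is Leibniz equality, so [=] on [svnset] is the
   neutrosophic equality. *)
Lemma svn_eqP (R : realType) (U : Type) (A B : svnset R U) :
  A = B <-> svn_sub A B /\ svn_sub B A.
Proof.
split=> [->|]; first by split=> u; split.
case: A B => [mA sA oA] [mB sB oB] [AB BA].
have Em : mA = mB.
  apply/funext => u; apply/le_anti.
  by case: (AB u) (BA u) => /= -> _ _ [-> _ _].
have Es : sA = sB.
  apply/funext => u; apply/le_anti.
  by case: (AB u) (BA u) => /= _ -> _ [_ -> _].
have Eo : oA = oB.
  apply/funext => u; apply/le_anti.
  by case: (AB u) (BA u) => /= _ _ -> [_ _ ->].
by rewrite Em Es Eo.
Qed.

Definition svn_inter (R : realType) (U : Type) (A B : svnset R U) :
    svnset R U :=
  SVNSet (fun u => Order.min (membership A u) (membership B u))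
         (fun u => Order.min (indeterminacy A u) (indeterminacy B u))
         (fun u => Order.max (nonmembership A u) (nonmembership B u)).

Definition svn_union (R : realType) (U : Type) (A B : svnset R U) :
    svnset R U :=
  SVNSet (fun u => Order.max (membership A u) (membership B u))
         (fun u => Order.max (indeterminacy A u) (indeterminacy B u))
         (fun u => Order.min (nonmembership A u) (nonmembership B u)).

Definition svn_empty (R : realType) (U : Type) : svnset R U :=
  SVNSet (fun=> 0%:i01) (fun=> 0%:i01) (fun=> 1%:i01).

Definition svn_filter_base (R : realType) (U : Type)
    (F : set (svnset R U)) : Prop :=
  [/\ F !=set0,
      ~ F (svn_empty R U)
    & forall A B, F A -> F B ->
        exists2 H, F H & svn_sub H (svn_inter A B)].

Definition svn_filter (R : realType) (U : Type)
    (F : set (svnset R U)) : Prop :=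
  svn_filter_base F /\ forall A B, F A -> svn_sub A B -> F B.

Definition svn_meet (R : realType) (U : Type) (F G : set (svnset R U)) :
    set (svnset R U) :=
  [set svn_union A B | A in F & B in G].

(* Main.v *)
Require Import Defs.
From mathcomp Require Import all_boot all_order all_algebra.
From mathcomp Require Import interval_inference.
From mathcomp Require Import boolp classical_sets reals.

Import Order.TTheory.

Local Open Scope classical_set_scope.

(** Under [svn_sub] the SVN-sets form a lattice with join [svn_union], meet [svn_inter] and least
    element [svn_empty]; the argument uses only this. Joins are monotone, so joining lower bounds
    taken in [F] and in [G] yields a lower bound in [svn_meet F G]. For filters, a join lies above
    each of its two terms, so upward closure puts [svn_meet F G] inside [F] and [G]; conversely a
    common member of [F] and [G] is its own join with itself ([svn_unionid]), which gives upward
    closure of [svn_meet F G]. *)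

Lemma svn_sub_refl (R : realType) (U : Type) (A : svnset R U) : svn_sub A A.
Proof. by move=> u; split. Qed.

Lemma svn_sub_trans (R : realType) (U : Type) (A B C : svnset R U) :
  svn_sub A B -> svn_sub B C -> svn_sub A C.
Proof.
move=> AB BC u; have [m1 s1 o1] := AB u; have [m2 s2 o2] := BC u.
by split; [exact: le_trans m2|exact: le_trans s2|exact: le_trans o1].
Qed.

Lemma svn_sub_unionl (R : realType) (U : Type) (A B : svnset R U) :
  svn_sub A (svn_union A B).
Proof. by move=> u; rewrite /= !le_max ge_min !lexx. Qed.

Lemma svn_sub_unionr (R : realType) (U : Type) (A B : svnset R U) :
  svn_sub B (svn_union A B).
Proof. by move=> u; rewrite /= !le_max ge_min !lexx !orbT. Qed.

Lemma svn_union_sub (R : realType) (U : Type) (A B C : svnset R U) :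
  svn_sub A C -> svn_sub B C -> svn_sub (svn_union A B) C.
Proof.
move=> AC BC u; have [m1 s1 o1] := AC u; have [m2 s2 o2] := BC u.
by split; rewrite /= ?ge_max ?le_min ?m1 ?s1 ?o1.
Qed.

(** The universal property of the meet: it lets the filter base condition be unpacked, and checked,
    one set at a time. *)
Lemma svn_sub_inter (R : realType) (U : Type) (A B C : svnset R U) :
  svn_sub C (svn_inter A B) <-> svn_sub C A /\ svn_sub C B.
Proof.
split=> [CAB|[CA CB] u].
  by split=> u; have [] := CAB u;
    rewrite /= !le_min ge_max => /andP[? ?] /andP[? ?] /andP[? ?].
have [m1 s1 o1] := CA u; have [m2 s2 o2] := CB u.
by split; rewrite /= ?ge_max ?le_min ?m1 ?s1 ?o1.
Qed.

(** The bounds 0 and 1 are carried by the type [{i01 R}]; [num_le] moves the comparison to [R],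
    where they apply. *)
Lemma svn_empty_sub (R : realType) (U : Type) (A : svnset R U) :
  svn_sub (svn_empty R U) A.
Proof. by move=> u; split; rewrite -num_le /=. Qed.

(** [A] lies below the union, here the least element, so antisymmetry applies. This keeps the empty
    set out of [svn_meet F G]. *)
Lemma svn_union_eq_empty (R : realType) (U : Type) (A B : svnset R U) :
  svn_union A B = svn_empty R U -> A = svn_empty R U.
Proof.
move=> AB0; apply/svn_eqP; split; last exact: svn_empty_sub.
by rewrite -AB0; exact: svn_sub_unionl.
Qed.

Lemma svn_unionid (R : realType) (U : Type) (A : svnset R U) :
  svn_union A A = A.
Proof.
apply/svn_eqP; split; last exact: svn_sub_unionl.
by apply: svn_union_sub; exact: svn_sub_refl.
Qed.

Lemma svn_filter_base_meet (R : realType) (U : Type) (F G : set (svnset R U)) :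
  svn_filter_base F -> svn_filter_base G -> svn_filter_base (svn_meet F G).
Proof.
move=> [[A0 FA0] F0 FI] [[B0 GB0] _ GI]; split.
- by exists (svn_union A0 B0); exists A0 => //; exists B0.
- by move=> [A FA [B _ /svn_union_eq_empty A0E]]; apply: F0; rewrite -A0E.
- move=> _ _ [A FA [B GB <-]] [A' FA' [B' GB' <-]].
  have [H FH /svn_sub_inter[HA HA']] := FI _ _ FA FA'.
  have [K GK /svn_sub_inter[KB KB']] := GI _ _ GB GB'.
  (* [H] lies below [A] and [A'], and [K] below [B] and [B'], so their join lies below both given
     unions. *)
  exists (svn_union H K); first by exists H => //; exists K.
  by apply/svn_sub_inter; split; apply: svn_union_sub;
    [exact: svn_sub_trans HA (svn_sub_unionl _ _ _ _)
    |exact: svn_sub_trans KB (svn_sub_unionr _ _ _ _)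
    |exact: svn_sub_trans HA' (svn_sub_unionl _ _ _ _)
    |exact: svn_sub_trans KB' (svn_sub_unionr _ _ _ _)].
Qed.

Theorem proposition3p20 (R : realType) (U : Type) (F G : set (svnset R U))
    (hF : svn_filter_base F) (hG : svn_filter_base G) :
  svn_filter_base (svn_meet F G) /\
  (svn_filter F -> svn_filter G ->
     [/\ svn_filter (svn_meet F G),
         svn_meet F G `<=` F
       & svn_meet F G `<=` G]).
Proof.
have hFG := svn_filter_base_meet _ _ _ _ hF hG.
split=> // -[_ Fup] [_ Gup].
have FGF : svn_meet F G `<=` F.
  by move=> _ [A FA [B _ <-]]; exact: Fup FA (svn_sub_unionl _ _ _ _).
have FGG : svn_meet F G `<=` G.
  by move=> _ [A _ [B GB <-]]; exact: Gup GB (svn_sub_unionr _ _ _ _).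
split=> //; split=> // A C FGA AC.
(* C lies in both filters, and C is its own union with itself. *)
exists C; first exact: Fup (FGF _ FGA) AC.
by exists C; [exact: Gup (FGG _ FGA) AC|exact: svn_unionid].
Qed.
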